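(* There is an absolute constant $K>0$ such that for every positive integer $n$ and every real $\xi$ with $2\le\xi\le n$, with probability at least $1-K(\log\xi)^{-1/3}$ the uniformly random permutation $\sigma\in\mathcal{S}_n$ satisfies \[ |C_{[m]}(\sigma)-\log m|<2\sqrt{\log m\,\log\log m}\qquad\text{for all integers } m \text{ with } \xi\le m\le n. \]
   Context: $\mathcal{S}_n$ is the symmetric group on $[n]=\{1,\ldots,n\}$. $C_{[m]}(\sigma)$ is the number of cycles of $\sigma$ of length at most $m$ (fixed points count as cycles of length 1). For $m=2$, where $\log\log m<0$ and the square root is not real, the inequality is regarded as failing. *)

(* Defs.v *)
From mathcomp Require Import all_boot all_order all_algebra all_fingroup.
From mathcomp Require Import reals exp.

Set Implicit Arguments.
Unset Strict Implicit.
Unset Printing Implicit Defensive.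

Import Order.TTheory GRing.Theory Num.Theory.

Local Open Scope ring_scope.

Definition cycles_upto (n m : nat) (s : 'S_n) : nat :=
  #|[set c in porbits s | (#|c| <= m)%N]|.

Definition unif_prob (R : realType) (T : finType) (A : {set T}) : R :=
  #|A|%:R / #|T|%:R.

(* Num.sqrt is 0 on negative arguments, so for m = 2, where
   ln (ln 2) < 0, the strict inequality is false. *)
Definition cycles_close (R : realType) (n m : nat) (s : 'S_n) : bool :=
  `|(cycles_upto m s)%:R - ln (m%:R : R)|
    < 2 * Num.sqrt (ln (m%:R : R) * ln (ln (m%:R : R))).

(* Main.v *)
Require Import Defs.
From mathcomp Require Import all_boot all_order all_algebra all_fingroup.
From mathcomp Require Import reals exp.
From mathcomp Require Import topology normedtype sequences derive realfun.
From mathcomp Require Import ring lra.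

(** The number C_m of cycles of length at most m behaves like a Poisson
    variable of mean H_m = 1 + 1/2 + ... + 1/m, which lies between ln (m+1) and
    1 + ln m. Write L = ln m. A deviation of 2 sqrt(L ln L) is 2 sqrt(ln L)
    standard deviations, so for a single m it has probability
    O(exp (- (2 sqrt(ln L))^2 / 2)) = O(L^-2).

    Since m |-> C_m is nondecreasing, it is enough to look at the milestones
    m = floor(e^j): while m runs from one milestone to the next, ln m moves by
    at most one, which is negligible against the permitted deviation
    ([cycles_close_between]). The union bound over the integers j above ln xi
    then costs O(sum_j j^-2) = O(1 / ln xi) ([upper_tail], [lower_tail],
    [sum_inv_sqr_le]); this is better than the required (ln xi)^(-1/3), and
    small values of ln xi are absorbed by the constant.

    The tails are Chernoff bounds, and they rest on the estimate
      E z^(C_m) <= 2 exp ((z - 1) H_m)      for 1/2 <= z <= 3/2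
    ([sum_expr_cycles_upto], [rising_le_expR]). Give each cycle of length k the
    weight theta_k, and let h_n be the mean, over the permutations of n points,
    of the product of the weights of the cycles. In a random permutation the
    cycle of a given point is equally likely to have each of the lengths
    1, ..., n, and given that cycle the remaining points carry a uniform
    permutation, so
      n h_n = theta_1 h_(n-1) + ... + theta_n h_0.
    The coefficients are nonnegative, so any sequence that starts from at least
    1 and satisfies this with >= in place of = bounds h from above
    ([cycle_sum_le]). For theta_k = z when k <= m and 1 otherwise, the exact
    solution is the product of the 1 + (z-1)/k over k <= n as long as n <= m,
    and twice its value at m is large enough to serve for every n > m
    ([majorant_rec]). *)

Set Implicit Arguments.
Unset Strict Implicit.
Unset Printing Implicit Defensive.

Import Order.TTheory GRing.Theory Num.Theory.
Import numFieldNormedType.Exports.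

Local Open Scope ring_scope.

(** * Removing a point from a cycle *)

Lemma eq_porbit_on (T : finType) (s t : {perm T}) (z : T) :
  {in porbit s z, s =1 t} -> porbit s z = porbit t z.
Proof.
move=> st; apply/porbit_setP.
have stX i : (s ^+ i)%g z = (t ^+ i)%g z.
  elim: i => [|i IHi]; first by rewrite !expg0.
  by rewrite !expgSr !permM -IHi st // mem_porbit.
by move=> u; apply/porbitP/porbitP => -[i ->]; exists i.
Qed.

Lemma porbit_fix (T : finType) (s : {perm T}) (x : T) :
  s x = x -> porbit s x = [set x].
Proof.
move=> sx; apply/setP => u; rewrite inE; apply/porbitP/eqP => [[i ->]|->].
  by elim: i => [|i IHi]; rewrite ?expg0 ?perm1 // expgSr permM IHi.
by exists 0%N; rewrite expg0 perm1.
Qed.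

(** Here [s] fixes [y], and composing it with the transposition inserts [y]
    into the cycle of [x], right after [x]. *)
Lemma porbit_tpermM (T : finType) (s : {perm T}) (x y : T) :
  x != y -> s y = y -> porbit (tperm x y * s)%g x = y |: porbit s x.
Proof.
move=> xy sy; set t := (tperm x y * s)%g.
have tx : t x = y by rewrite permM tpermL.
have ty : t y = s x by rewrite permM tpermR.
have tu u : u != x -> u != y -> t u = s u.
  by move=> ux uy; rewrite permM tpermD // eq_sym.
have tS u : u \in porbit t x -> t u \in porbit t x.
  by case/porbitP=> i ->; rewrite -permM -expgSr mem_porbit.
have sS u : u \in porbit s x -> s u \in porbit s x.
  by case/porbitP=> i ->; rewrite -permM -expgSr mem_porbit.
have yt : y \in porbit t x by rewrite -tx tS // porbit_id.
apply/eqP; rewrite eqEsubset; apply/andP; split; apply/subsetP => u.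
  case/porbitP=> i ->; elim: i => [|i IHi].
    by rewrite expg0 perm1 !inE porbit_id orbT.
  rewrite expgSr permM; move: IHi; set v := (t ^+ i)%g x; clearbody v.
  rewrite !inE; have [-> _|vy] := eqVneq v y.
    by rewrite ty sS ?orbT // porbit_id.
  have [-> _|vx /= vs] := eqVneq v x; first by rewrite tx eqxx.
  by rewrite tu // sS ?orbT.
rewrite !inE => /orP[/eqP -> //|/porbitP[i ->]].
elim: i => [|i IHi]; first by rewrite expg0 perm1 porbit_id.
rewrite expgSr permM; move: IHi; set v := (s ^+ i)%g x; clearbody v.
have [-> _|vy] := eqVneq v y; first by rewrite sy.
have [-> _|vx vt] := eqVneq v x; first by rewrite -ty tS.
by rewrite -tu // tS.
Qed.

Lemma notin_porbit (T : finType) (s : {perm T}) (x y : T) :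
  s y = y -> x != y -> y \notin porbit s x.
Proof.
by move=> sy xy; rewrite porbit_sym porbit_fix // inE.
Qed.

(** When [s] is supported in [A] this is the weight of the cycles of [s] seen as
    a permutation of [A]. Erasing a point from [A] drops its cycle from the
    product, which is how one cycle gets singled out below. *)
Definition cycle_weight (R : comNzRingType) (T : finType) (theta : nat -> R)
  (A : {set T}) (s : {perm T}) : R :=
  \prod_(c in porbits s | c \subset A) theta #|c|.

(** Insertion of [y] into the cycle of [x] leaves the other cycles alone: on a
    cycle that avoids [x] and [y] the two permutations agree. *)
Lemma cycle_weight_tpermM (R : comNzRingType) (T : finType) (theta : nat -> R)
    (A : {set T}) (s : {perm T}) (x y : T) :
  x != y -> s y = y ->
  cycle_weight theta (A :\ x) (tperm x y * s) =
  cycle_weight theta (A :\ y :\ x) s.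
Proof.
move=> xy sy; apply: eq_bigl => c; set t := (tperm x y * s)%g.
have eqst u : u != x -> u != y -> t u = s u.
  by move=> ux uy; rewrite permM tpermD // eq_sym.
rewrite !subsetD1.
apply/idP/idP.
  case/and3P=> /imsetP[z _ c_def] cA xc.
  have yc : y \notin c.
    apply: contra xc; rewrite c_def -eq_porbit_mem => /eqP <-.
    by rewrite porbit_sym porbit_tpermM // !inE eqxx.
  have c_s : c = porbit s z.
    rewrite c_def; apply: eq_porbit_on => u; rewrite -c_def => uc.
    by apply: eqst; [apply: contraNneq xc | apply: contraNneq yc] => <-.
  by rewrite cA xc yc c_s imset_f.
case/andP=> /imsetP[z _ c_def] /andP[/andP[cA yc] xc].
have c_t : c = porbit t z.
  rewrite c_def; apply: eq_porbit_on => u; rewrite -c_def => uc; apply/esym.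
  by apply: eqst; [apply: contraNneq xc | apply: contraNneq yc] => <-.
by rewrite cA xc c_t imset_f.
Qed.

Definition cycle_sum (R : comNzRingType) (T : finType) (theta : nat -> R)
  (A : {set T}) : R := \sum_(s : {perm T} | perm_on A s) cycle_weight theta A s.

(** The cycle of [x] is weighted by [phi] and the others by [theta], so that
    [phi] can be shifted while the points of that cycle are removed. *)
Definition marked_cycle_sum (R : comNzRingType) (T : finType)
  (theta phi : nat -> R) (A : {set T}) (x : T) : R :=
  \sum_(s : {perm T} | perm_on A s)
     phi #|porbit s x| * cycle_weight theta (A :\ x) s.

Lemma cycle_sum_marked (R : comNzRingType) (T : finType) (theta : nat -> R)
    (A : {set T}) (x : T) :
  x \in A -> cycle_sum theta A = marked_cycle_sum theta theta A x.
Proof.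
move=> xA; apply: eq_bigr => s sA; rewrite /cycle_weight.
have xsA : porbit s x \subset A.
  apply/subsetP=> _ /porbitP[i ->].
  by elim: i => [|i IHi]; rewrite ?expg0 ?perm1 // expgSr permM perm_closed.
rewrite (bigD1 (porbit s x)) ?imset_f //=; congr (_ * _).
apply: eq_bigl => c; rewrite subsetD1 -andbA; apply: andb_id2l.
case/imsetP=> z _ ->; congr (_ && _); congr (~~ _).
by rewrite eq_sym eq_porbit_mem.
Qed.

Lemma perm_onD1 (T : finType) (A : {set T}) (s : {perm T}) (y : T) :
  perm_on (A :\ y) s = perm_on A s && (s y == y).
Proof.
apply/subsetP/andP => [sAy|[/subsetP sA /eqP sy] u su]; last first.
  by rewrite !inE sA // andbT; apply: contraNneq su => ->; apply/eqP.
split; first by apply/subsetP=> u /sAy /setD1P[].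
by have := sAy y; rewrite !inE eqxx; case: (s y == y) => // /(_ isT).
Qed.

(** Split according to the image [y] of [x]. Either [x] is fixed, or [y] can be
    removed from the cycle of [x], which shortens that cycle by one: such an [s]
    is [tperm x y * s'] for a unique [s'] supported in [A :\ y]. *)
Lemma marked_cycle_sum_rec (R : comNzRingType) (T : finType)
    (theta phi : nat -> R) (A : {set T}) (x : T) :
  x \in A ->
  marked_cycle_sum theta phi A x =
    phi 1%N * cycle_sum theta (A :\ x)
    + \sum_(y in A :\ x) marked_cycle_sum theta (phi \o succn) (A :\ y) x.
Proof.
move=> xA; rewrite /marked_cycle_sum.
rewrite (partition_big (fun s : {perm T} => s x) (mem A)) /=; last first.
  by move=> s sA; rewrite perm_closed.
rewrite (bigD1 x) //=; congr (_ + _).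
  rewrite /cycle_sum mulr_sumr; apply: eq_big => s; first by rewrite perm_onD1.
  by case/andP=> _ /eqP sx; rewrite porbit_fix // cards1.
apply: eq_big => [y|y /andP[yA yx]]; first by rewrite !inE andbC.
rewrite (reindex_inj (mulgI (tperm x y))) /=.
have onE s : perm_on A (tperm x y * s)%g && ((tperm x y * s)%g x == y)
             = perm_on (A :\ y) s.
  rewrite perm_onD1 permM tpermL.
  have txy : perm_on A (tperm x y).
    apply: subset_trans (tperm_on x y) _.
    by apply/subsetP=> u; rewrite !inE => /orP[]/eqP->.
  congr (_ && _); apply/idP/idP => [|sA]; last exact: perm_onM.
  by move=> /(perm_onM txy); rewrite mulgA tperm2 mul1g.
apply: eq_big => // s; rewrite onE perm_onD1 => /andP[_ /eqP sy].
have xy : x != y by rewrite eq_sym.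
by rewrite porbit_tpermM // cardsU1 notin_porbit // add1n cycle_weight_tpermM.
Qed.

(** Comparison principle: iterating [marked_cycle_sum_rec] until the cycle of
    [x] closes after [k] steps gives the recurrence by the length of that cycle,
    and a supersolution of it dominates by induction on the size of [A]. *)
Lemma cycle_sum_le (R : realDomainType) (T : finType) (theta h : nat -> R) :
    (forall k, 0 <= theta k) -> 1 <= h 0%N ->
    (forall n, \sum_(k < n.+1) theta k.+1 * h (n - k)%N <= n.+1%:R * h n.+1) ->
  forall A : {set T}, cycle_sum theta A <= #|A|`!%:R * h #|A|.
Proof.
move=> theta0 h0 hrec A; move: {2}#|A|.+1 (ltnSn #|A|) => N.
elim: N A => // N IHN A; rewrite ltnS => AN.
(* At a step of the iteration [phi] is [theta] shifted by the number of points
   already removed, hence the quantification over [phi]. *)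
have marked n : (n < N)%N -> forall (phi : nat -> R) (B : {set T}) (x : T),
    (forall k, 0 <= phi k) -> x \in B -> #|B| = n.+1 ->
  marked_cycle_sum theta phi B x
    <= n`!%:R * \sum_(k < n.+1) phi k.+1 * h (n - k)%N.
  elim: n => [|n IHn] nN phi B x phi0 xB Bn.
    have Bx : #|B :\ x| = 0%N by move: Bn; rewrite (cardsD1 x) xB => -[].
    rewrite marked_cycle_sum_rec // big_ord1 fact0 mul1r.
    have/eqP Bx0 := Bx; rewrite cards_eq0 in Bx0.
    rewrite (eqP Bx0) big_set0 addr0; apply: ler_wpM2l => //.
    by have := IHN set0; rewrite cards0 fact0 mul1r; apply.
  have BDn y : y \in B -> #|B :\ y| = n.+1.
    by move=> yB; move: Bn; rewrite (cardsD1 y) yB => -[].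
  rewrite marked_cycle_sum_rec // big_ord_recl subn0 mulrDr mulrCA.
  apply: lerD; first by rewrite ler_wpM2l // -(BDn x xB) IHN // BDn.
  apply: (@le_trans _ _ (\sum_(y in B :\ x)
      n`!%:R * \sum_(k < n.+1) phi k.+2 * h (n - k)%N)).
    apply: ler_sum => y /setD1P[yx yB].
    apply: (IHn (ltnW nN) (phi \o succn)); rewrite ?BDn //.
      by move=> k; apply: phi0.
    by rewrite !inE eq_sym yx.
  rewrite sumr_const BDn // factS natrM -mulrA [leRHS]mulr_natl.
  apply: ler_wMn2r; apply: ler_wpM2l => //.
case: (set_0Vmem A) => [->|[x xA]].
  rewrite /cycle_sum cards0 fact0 mul1r (big_pred1 1%g) => [|s]; last first.
    apply/idP/eqP => [sA|->]; last exact: perm_on1.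
    by apply: perm_on_id sA _; rewrite cards0.
  rewrite /cycle_weight big_pred0 // => c; apply/negP=> /andP[/imsetP[z _ ->]].
  by rewrite subset0 -cards_eq0 (negPf (card_porbit_neq0 _ _)).
have [n An] : exists n, #|A| = n.+1 by exists #|A :\ x|; rewrite (cardsD1 x) xA.
rewrite (cycle_sum_marked _ xA) An.
apply: le_trans (marked n _ _ _ _ _ xA An) _ => //; first by rewrite -An.
by rewrite factS mulnC natrM -mulrA ler_wpM2l.
Qed.

(** * A supersolution of the recurrence *)

(** The mean of z^(number of cycles) over the permutations of n points. *)
Definition rising (R : fieldType) (z : R) (n : nat) : R :=
  \prod_(k < n) (1 + (z - 1) / k.+1%:R).

Lemma risingS (R : realFieldType) (z : R) (n : nat) :
  n.+1%:R * rising z n.+1 = (n%:R + z) * rising z n.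
Proof.
rewrite /rising big_ord_recr /= mulrCA mulrC; congr (_ * _).
have n0 : n.+1%:R != 0 :> R by rewrite pnatr_eq0.
by rewrite mulrDr mulr1 mulrCA mulfV // mulr1 -natr1; ring.
Qed.

Lemma rising_gt0 (R : realFieldType) (z : R) (n : nat) : 0 < z -> 0 < rising z n.
Proof.
move=> z0; elim: n => [|n IHn]; first by rewrite /rising big_ord0 ltr01.
rewrite -(@pmulr_rgt0 _ n.+1%:R) ?ltr0Sn // risingS mulr_gt0 //.
by rewrite ltr_wpDl.
Qed.

Lemma sum_rising (R : realFieldType) (z : R) (n : nat) :
  z * \sum_(j < n) rising z j = n%:R * rising z n.
Proof.
elim: n => [|n IHn]; first by rewrite big_ord0 mulr0 mul0r.
by rewrite big_ord_recr /= mulrDr IHn risingS; ring.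
Qed.

Lemma rising_mono (R : realFieldType) (z : R) (n m : nat) :
  1 <= z -> (n <= m)%N -> rising z n <= rising z m.
Proof.
move=> z1; have z0 : 0 < z by lra.
elim: m => [|m IHm]; first by rewrite leqn0 => /eqP->.
rewrite leq_eqVlt => /predU1P[-> //|]; rewrite ltnS => /IHm /le_trans; apply.
rewrite -(@ler_pM2l _ m.+1%:R) ?ltr0Sn // risingS ler_wpM2r //.
  by rewrite ltW // rising_gt0.
by rewrite -natr1 lerD2l.
Qed.

(** Exact for [n <= m]; the factor 2 pays for the fact that the true mean
    keeps changing, within a bounded factor, once [n] exceeds [m]. *)
Definition majorant (R : fieldType) (z : R) (m n : nat) : R :=
  if (n <= m)%N then rising z n else 2 * rising z m.

Lemma sum_majorant (R : realFieldType) (z : R) (m d : nat) :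
  \sum_(j < (d + m).+1) majorant z m j =
    \sum_(j < m.+1) rising z j + d%:R * (2 * rising z m).
Proof.
elim: d => [|d IHd].
  rewrite mul0r addr0; apply: eq_bigr => j _.
  by rewrite /majorant -ltnS ltn_ord.
rewrite big_ord_recr /= IHd /majorant leqNgt ltnS leq_addl /=.
by rewrite -[d.+1%:R]natr1; ring.
Qed.

(** For [m <= n], in units of [P = rising z m], the values up to [m] add up to
    [1 + m/z] by [sum_rising], and the others to [2 (n - m)]. The weight of the
    short cycles exceeds 1 by at most [b], and they contribute an excess of at
    most [2 b m]. The range of [z] is what makes [m/z + 2 b m <= 2 m], so that
    the total stays below [2 (n + 1)]. *)
Lemma majorant_rec (R : realFieldType) (z : R) (m n : nat) :
  1 / 2 <= z <= 3 / 2 ->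
  \sum_(k < n.+1) (if (k.+1 <= m)%N then z else 1) * majorant z m (n - k)
    <= n.+1%:R * majorant z m n.+1.
Proof.
move=> /andP[zlo zhi]; have z0 : 0 < z by lra.
have P0 := rising_gt0 m z0; set P := rising z m in P0.
have [nm|mn] := leqP n.+1 m.
  rewrite /majorant nm -sum_rising mulr_sumr (reindex_inj rev_ord_inj) /=.
  apply: ler_sum => k _; rewrite subSS subKn; last by rewrite -ltnS.
  have km : (k <= m)%N by apply: leq_trans (ltnW (ltn_ord k)) nm.
  by rewrite km (leq_ltn_trans (leq_subr _ _) nm).
(* [b] is the positive part of [z - 1]. *)
pose b : R := if z <= 1 then 0 else z - 1.
have b0 : 0 <= b by rewrite /b; case: (lerP z 1) => ?; lra.
have h0 j : 0 <= majorant z m j.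
  by rewrite /majorant; case: ifP => _; rewrite ?mulr_ge0 // ltW // rising_gt0.
have bh j : b * majorant z m j <= b * (2 * P).
  rewrite /b; case: (lerP z 1) => z1; first by rewrite !mul0r.
  apply: ler_wpM2l; first by lra.
  rewrite /majorant; case: leqP => jm //.
  by apply: (le_trans (rising_mono (ltW z1) jm)); rewrite -/P; lra.
have bound (k : 'I_n.+1) :
    (if (k < m)%N then z else 1) * majorant z m (n - k)
    <= majorant z m (n - k) + (if (k < m)%N then b * (2 * P) else 0).
  have zb : z <= 1 + b by rewrite /b; case: (lerP z 1) => ?; lra.
  case: ifP => _; last by rewrite mul1r addr0.
  apply: (le_trans (ler_wpM2r (h0 _) zb)).
  by rewrite mulrDl mul1r lerD2l bh.
apply: (le_trans (ler_sum _ (fun k _ => bound k))).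
have -> : \sum_(k < n.+1) (majorant z m (n - k)
      + (if (k < m)%N then b * (2 * P) else 0))
    = \sum_(k < n.+1) majorant z m (n - k) + m%:R * (b * (2 * P)).
  have ifsum (c : R) : \sum_(k < n.+1) (if (k < m)%N then c else 0) = m%:R * c.
    rewrite -big_mkcond -(big_ord_widen _ (fun=> c)); last exact: ltnW.
    by rewrite sumr_const card_ord mulr_natl.
  by rewrite big_split /= ifsum.
have -> : \sum_(k < n.+1) majorant z m (n - k) = \sum_(j < n.+1) majorant z m j.
  rewrite [RHS](reindex_inj rev_ord_inj) /=.
  by apply: eq_bigr => k _; rewrite subSS.
rewrite ltnS in mn; rewrite -(subnK mn) sum_majorant subnK //.
rewrite /majorant leqNgt ltnS mn /= -/P.
have sumE : \sum_(j < m.+1) rising z j = (1 + m%:R / z) * P.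
  apply: (mulfI (lt0r_neq0 z0)); rewrite sum_rising risingS -/P mulrA.
  by congr (_ * _); rewrite mulrDr mulr1 mulrCA mulfV ?lt0r_neq0 // mulr1 addrC.
rewrite sumE natrB // -[n.+1%:R]natr1.
have key : m%:R / z + 2 * b * m%:R <= 2 * m%:R.
  have [zi_lo zi_hi] : z^-1 <= 2 /\ (1 < z -> z^-1 <= 1).
    split=> [|z1]; last by rewrite invf_le1 // ltW.
    by rewrite -[2]invrK lef_pV2 ?posrE ?invr_gt0 ?ltr0n //; lra.
  rewrite mulrC -mulrDl ler_wpM2r // /b; case: (lerP z 1) => z1; first by lra.
  by have := zi_hi z1; lra.
rewrite [leRHS](_ : _ = (2 * n%:R + 2) * P); last by ring.
rewrite (_ : _ + _ + _ =
  (1 + 2 * n%:R - 2 * m%:R + (m%:R / z + 2 * b * m%:R)) * P); last by ring.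
by rewrite ler_wpM2r ?(ltW P0) //; lra.
Qed.

(** For [n < m] the bound compares [rising z n] with [rising z m], which needs
    monotonicity and so [1 <= z]. *)
Lemma sum_expr_cycles_upto (R : realFieldType) (z : R) (m n : nat) :
  1 / 2 <= z <= 3 / 2 -> 1 <= z \/ (m <= n)%N ->
  \sum_(s : 'S_n) z ^+ cycles_upto m s <= n`!%:R * (2 * rising z m).
Proof.
move=> zb zmn; have z0 : 0 < z by case/andP: zb; lra.
pose theta k : R := if (k <= m)%N then z else 1.
have := @cycle_sum_le R 'I_n theta (majorant z m) _ _ _ [set: 'I_n].
rewrite cardsT card_ord => cycle_sum_le.
have -> : \sum_(s : 'S_n) z ^+ cycles_upto m s = cycle_sum theta [set: 'I_n].
  apply: eq_big => s; first by apply/esym/subsetP=> u _; rewrite inE.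
  move=> _; rewrite /cycle_weight (eq_bigl (mem (porbits s))); last first.
    by move=> c; rewrite subsetT andbT.
  rewrite -big_mkcondr /= /cycles_upto -prodr_const; apply: eq_bigl => c.
  by rewrite inE.
apply: (le_trans (cycle_sum_le _ _ _)).
- by move=> k; rewrite /theta; case: ifP => _; lra.
- by rewrite /majorant leq0n /rising big_ord0.
- by move=> k; apply: majorant_rec.
rewrite ler_wpM2l // /majorant; case: leqP => [nm|//].
have P0 := rising_gt0 m z0.
case: zmn => [z1|mn]; last first.
  by have -> : n = m by [apply/eqP; rewrite eqn_leq nm]; lra.
by apply: (le_trans (rising_mono z1 nm)); lra.
Qed.

(** * Second-order bounds for the exponential *)

(** The function p(x) e^(-x) has derivative (p' - p)(x) e^(-x), so it is
    nondecreasing on [0, 1]. *)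
Lemma horner_expR_le (R : realType) (p : {poly R}) (w : R) :
  (forall x : R, 0 <= x <= 1 -> p.[x] <= p^`().[x]) -> 0 <= w <= 1 ->
  p.[0] * expR w <= p.[w].
Proof.
move=> pp /andP[w0 w1].
pose F (x : R) := p.[x] * expR (- x).
have dF (x : R) : is_derive x 1 F ((p^`().[x] - p.[x]) * expR (- x)).
  have H := is_deriveM (is_derive_poly p x)
    (is_derive1_comp (is_derive_expR (- x)) (is_deriveNid x 1)).
  apply: (is_derive_eq H); rewrite /= /GRing.scale /=; ring.
suff : F 0 <= F w.
  by rewrite /F oppr0 expR0 mulr1 expRN ler_pdivlMr ?expR_gt0.
apply: (@ger0_derive1_ndecr R F 0 1 _ _ _ 0 w) => //.
  move=> x; rewrite in_itv /= => /andP[x0 x1].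
  have Fx := dF x; rewrite derive1E derive_val mulr_ge0 ?expR_ge0 // subr_ge0 pp //.
  by rewrite !ltW.
apply: derivable_within_continuous => x _.
by have [] := dF x.
Qed.

Lemma expR_le_cubic (R : realType) (w : R) : 0 <= w <= 1 ->
  expR w <= 1 + w + w ^+ 2 / 2 + w ^+ 3.
Proof.
move=> w01; have := @horner_expR_le R (1 + 'X + 2^-1 *: 'X^2 + 'X^3) w.
rewrite !poly.derivE !hornerE /= !expr0n /= => /(_ _ w01) le_w.
apply: (le_trans _ (le_trans (le_w _) _)); rewrite ?mulr0 ?addr0 ?mul1r //.
  by move=> x /andP[x0 x1]; rewrite !hornerE /=; nra.
by rewrite lerD2r lerD2l; lra.
Qed.

Lemma expRN_le_quadratic (R : realType) (w : R) : 0 <= w <= 1 ->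
  expR (- w) <= 1 - w + w ^+ 2 / 2.
Proof.
move=> w01; have := @horner_expR_le R (- (1 + 'X + 2^-1 *: 'X^2)) w.
rewrite !poly.derivE !hornerE /= => /(_ _ w01).
rewrite ?mulr0 ?addr0 ?mulN1r => le_w.
have {le_w} : 1 + w + w ^+ 2 / 2 <= expR w.
  rewrite -lerN2; apply: (le_trans (le_w _)); last by lra.
  by move=> x /andP[x0 x1]; rewrite !hornerE /=; nra.
move=> le_w; rewrite expRN -div1r ler_pdivrMr ?expR_gt0 //.
case/andP: w01 => w0 w1.
apply: (@le_trans _ _ ((1 - w + w ^+ 2 / 2) * (1 + w + w ^+ 2 / 2))); last first.
  by apply: ler_wpM2l => //; nra.
rewrite [leRHS](_ : _ = 1 + (w ^+ 2) ^+ 2 / 4); last by field.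
by rewrite lerDl divr_ge0 ?sqr_ge0.
Qed.

(** * Chernoff bounds *)

Lemma rising_le_expR (R : realType) (z : R) (m : nat) : 0 < z ->
  rising z m <= expR ((z - 1) * \sum_(k < m) k.+1%:R^-1).
Proof.
move=> z0; rewrite mulr_sumr expR_sum; apply: ler_prod => k _.
rewrite expR_ge1Dx andbT.
have k0 : 0 < k.+1%:R :> R by rewrite ltr0Sn.
have -> : 1 + (z - 1) / k.+1%:R = (k%:R + z) / k.+1%:R.
  by move: (lt0r_neq0 k0); rewrite -natr1 => kN0; field.
by rewrite divr_ge0 ?(ltW k0) // addr_ge0 // ltW.
Qed.

Lemma ln_natS_sub (R : realType) (m : nat) :
  m.+2%:R^-1 <= ln m.+2%:R - ln m.+1%:R :> R /\
  ln m.+2%:R - ln m.+1%:R <= m.+1%:R^-1 :> R.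
Proof.
have m1 : 0 < m.+1%:R :> R by rewrite ltr0Sn.
have m2 : 0 < m.+2%:R :> R by rewrite ltr0Sn.
have mE : m.+2%:R = m.+1%:R + 1 :> R by rewrite natr1.
split.
  rewrite -lerN2 opprB -ln_div ?posrE // (_ : _ / _ = 1 + (- m.+2%:R^-1)).
    by apply: le_ln1Dx; rewrite ltrN2 invf_lt1 // ltr1n.
  by move: m1 m2; rewrite mE; move: (m.+1%:R) => a a0 a1; field; exact: lt0r_neq0.
rewrite -ln_div ?posrE // (_ : _ / _ = 1 + m.+1%:R^-1).
  by apply: le_ln1Dx; rewrite (@lt_trans _ _ 0) ?ltrN10 // invr_gt0.
by move: m1; rewrite mE; move: (m.+1%:R) => a a0; field; exact: lt0r_neq0.
Qed.

Lemma sum_inv_le_ln (R : realType) (m : nat) : (0 < m)%N ->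
  \sum_(k < m) k.+1%:R^-1 <= 1 + ln m%:R :> R.
Proof.
case: m => // m _; elim: m => [|m IHm].
  by rewrite big_ord1 invr1 ln1 addr0.
rewrite big_ord_recr /=.
have [inv_le _] := ln_natS_sub R m.
by apply: (le_trans (lerD IHm inv_le)); rewrite -addrA subrKC.
Qed.

Lemma ln_le_sum_inv (R : realType) (m : nat) :
  ln m.+1%:R <= \sum_(k < m) k.+1%:R^-1 :> R.
Proof.
elim: m => [|m IHm]; first by rewrite big_ord0 ln1.
rewrite big_ord_recr /=.
have [_ le_inv] := ln_natS_sub R m.
by rewrite -(subrKC (ln m.+1%:R) (ln m.+2%:R)) lerD.
Qed.

Lemma unif_prob_le (R : realType) (T : finType) (A B : {set T}) :
  A \subset B -> unif_prob R A <= unif_prob R B.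
Proof. by move=> AB; rewrite ler_wpM2r ?invr_ge0 // ler_nat subset_leq_card. Qed.

(** Both tails at once: for [w > 0] the event is [a <= C_m], for [w < 0] it is
    [C_m <= a]. *)
Lemma chernoff_cycles_upto (R : realType) (w a : R) (m n : nat) :
  1 / 2 <= expR w <= 3 / 2 -> 0 <= w \/ (m <= n)%N ->
  unif_prob R [set s : 'S_n | w * a <= w * (cycles_upto m s)%:R] <=
    2 * rising (expR w) m * expR (- (w * a)).
Proof.
move=> zb wmn; have f0 : 0 < n`!%:R :> R by rewrite ltr0n fact_gt0.
rewrite /unif_prob card_Sn ler_pdivrMr // mulrAC expRN ler_pdivlMr ?expR_gt0 //.
rewrite [leLHS]mulrC [leRHS]mulrC.
apply: le_trans (sum_expr_cycles_upto zb _); last first.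
  case: wmn => [w0|]; [left | by right].
  by rewrite -expR0 ler_expR.
rewrite -sum1_card natr_sum big_mkcond mulr_sumr; apply: ler_sum => s _.
rewrite inE; case: ifP => [aC|_]; last by rewrite mulr0 exprn_ge0 ?expR_ge0.
by rewrite mulr1 -expRM_natr ler_expR.
Qed.

(** With t = 2 sqrt(j ln j) the permitted deviation at mean j, the Chernoff
    exponent - t w + j w^2 / 2 is minimal at w = t / j, where it is - 2 ln j. *)
Definition tilt (R : realType) (j : nat) : R := 2 * Num.sqrt (ln j%:R / j%:R).

(** The last bound controls the cubic error j w^3 in the Chernoff exponent. It
    holds because (ln j)^3 <= 27 j, which gives (j w^3)^2 <= 64 * 27 <= 42^2. The
    threshold 4000 then forces w <= 1/4, since 42 * 64 < 4000. *)
Lemma tilt_bounds (R : realType) (j : nat) : (4000 <= j)%N ->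
  [/\ 0 <= tilt R j <= 1 / 4, j%:R * tilt R j ^+ 2 = 4 * ln j%:R
    & j%:R * tilt R j ^+ 3 <= 42].
Proof.
rewrite /tilt => j4; set w := 2 * _; have j4R : 4000 <= j%:R :> R by rewrite ler_nat.
set x : R := j%:R in w j4R *; have x0 : 0 < x by lra.
set y := ln x in w *; have y0 : 0 <= y by rewrite ln_ge0 //; lra.
have w0 : 0 <= w by rewrite mulr_ge0 ?sqrtr_ge0.
have w2 : w ^+ 2 = 4 * y / x.
  by rewrite exprMn sqr_sqrtr ?divr_ge0 ?(ltW x0) // mulrA; congr (_ * _ / _); ring.
clearbody w.
have xw2 : x * w ^+ 2 = 4 * y by rewrite w2 mulrC divfK ?lt0r_neq0.
(* Cube [1 + y/3 <= expR (y/3)]. *)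
have y3 : y ^+ 3 <= 27 * x.
  have -> : x = expR (y / 3) ^+ 3.
    by rewrite -expRM_natr divfK ?pnatr_eq0 // lnK ?posrE.
  have := expR_ge1Dx (y / 3); set e := expR _ => ye.
  have : (y / 3) ^+ 3 <= e ^+ 3.
    by apply: lerXn2r; rewrite ?nnegrE ?expR_ge0 ?divr_ge0 //; lra.
  rewrite exprMn; lra.
have xw3 : x * w ^+ 3 <= 42.
  rewrite -(@ler_pXn2r _ 2) ?nnegrE ?mulr_ge0 ?exprn_ge0 ?(ltW x0) //.
  have -> : (x * w ^+ 3) ^+ 2 = 64 * y ^+ 3 / x.
    rewrite -[RHS](_ : (x * w ^+ 2) ^+ 3 / x = _); last by rewrite xw2; ring.
    by field; exact: lt0r_neq0.
  by rewrite ler_pdivrMr //; nra.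
split=> //; rewrite w0 /= leNgt; apply/negP => w4.
clear -x xw3 j4R w4.
have : (1 / 4) ^+ 3 <= w ^+ 3 by apply: lerXn2r; rewrite ?nnegrE //; lra.
nra.
Qed.

(** The main terms of the exponent add up to - 2 ln j. The error terms are at most
    42, from j w^3, plus 2 (w + w^2/2 + w^3) <= 1, from the gap of 2 between
    [H_m] and [j]. *)
Lemma upper_tail (R : realType) (j m n : nat) :
  (4000 <= j)%N -> (0 < m)%N -> ln m%:R <= j%:R + 1 :> R ->
  unif_prob R [set s : 'S_n | j%:R + tilt R j * j%:R <= (cycles_upto m s)%:R]
    <= 2 * expR 43 / j%:R ^+ 2.
Proof.
move=> j4 m0 mj; have [] := tilt_bounds R j4; set w := tilt R j.
set x : R := j%:R => /andP[w0 w4] xw2 xw3.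
have x0 : 0 < x by rewrite ltr0n (leq_trans _ j4).
have w01 : 0 <= w <= 1 by rewrite w0 /=; lra.
have ew := expR_le_cubic w01.
have ew1 := expR_ge1Dx w.
apply: (@le_trans _ _ (2 * rising (expR w) m * expR (- (w * (x + w * x))))).
  have zb : 1 / 2 <= expR w <= 3 / 2 by apply/andP; split; nra.
  apply: le_trans (chernoff_cycles_upto (x + w * x) zb (or_introl w0)).
  apply/unif_prob_le/subsetP => s; rewrite !inE => sm.
  exact: ler_wpM2l.
rewrite -mulrA -[leRHS]mulrA ler_pM2l //.
apply: (le_trans (ler_wpM2r (expR_ge0 _) (rising_le_expR m (expR_gt0 w)))).
have -> : (x ^+ 2)^-1 = expR (- (2 * ln x)).
  by rewrite expRN mulrC expRM_natr lnK ?posrE.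
rewrite -!expRD ler_expR.
have H := sum_inv_le_ln R m0.
set S := \sum_(k < m) _ in H *.
have : (expR w - 1) * S <= (w + w ^+ 2 / 2 + w ^+ 3) * (x + 2).
  apply: (@le_trans _ _ ((expR w - 1) * (x + 2))).
    by apply: ler_wpM2l; lra.
  by apply: ler_wpM2r; lra.
move: (expR w) => e. clear -w0 w4 xw2 xw3 x0.
move: (ln x) xw2 => y xw2.
nra.
Qed.

Lemma lower_tail (R : realType) (j m n : nat) :
  (4000 <= j)%N -> (m <= n)%N -> j%:R <= ln m.+1%:R :> R ->
  unif_prob R [set s : 'S_n | (cycles_upto m s)%:R <= j%:R + 1 - tilt R j * j%:R]
    <= 2 * expR 43 / j%:R ^+ 2.
Proof.
move=> j4 mn mj; have [] := tilt_bounds R j4; set w := tilt R j.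
set x : R := j%:R => /andP[w0 w4] xw2 xw3.
have x0 : 0 < x by rewrite ltr0n (leq_trans _ j4).
have w01 : 0 <= w <= 1 by rewrite w0 /=; lra.
have ew := expRN_le_quadratic w01.
have ew1 := expR_ge1Dx (- w).
have em1 : expR (- w) <= 1 by rewrite -expR0 ler_expR; lra.
apply: (@le_trans _ _
  (2 * rising (expR (- w)) m * expR (- (- w * (x + 1 - w * x))))).
  have zb : 1 / 2 <= expR (- w) <= 3 / 2 by apply/andP; split; lra.
  apply: le_trans (chernoff_cycles_upto (x + 1 - w * x) zb (or_intror mn)).
  apply/unif_prob_le/subsetP => s; rewrite !inE => sm.
  by rewrite !mulNr lerN2 ler_wpM2l.
rewrite -mulrA -[leRHS]mulrA ler_pM2l //.
apply: (le_trans (ler_wpM2r (expR_ge0 _) (rising_le_expR m (expR_gt0 _)))).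
have -> : (x ^+ 2)^-1 = expR (- (2 * ln x)).
  by rewrite expRN mulrC expRM_natr lnK ?posrE.
rewrite -!expRD ler_expR.
have H := le_trans mj (ln_le_sum_inv R m).
set S := \sum_(k < m) _ in H *.
have : (expR (- w) - 1) * S <= (- w + w ^+ 2 / 2) * x.
  apply: (@le_trans _ _ ((expR (- w) - 1) * x)).
    by apply: ler_wnM2l; lra.
  by apply: ler_wpM2r; lra.
move: (expR (- w)) => e; clear -w0 w4 xw2 xw3 x0.
move: (ln x) xw2 => y xw2.
nra.
Qed.

(** * Union over the milestones *)

Lemma unif_probU (R : realType) (T : finType) (A B : {set T}) :
  unif_prob R (A :|: B) <= unif_prob R A + unif_prob R B.
Proof.
rewrite /unif_prob -mulrDl -natrD ler_wpM2r ?invr_ge0 // ler_nat.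
by rewrite -(leq_add2r #|A :&: B|) cardsUI leq_addr.
Qed.

Lemma unif_prob_bigcup (R : realType) (T : finType) (J N : nat)
    (A : nat -> {set T}) :
  unif_prob R (\bigcup_(J <= j < N) A j) <= \sum_(J <= j < N) unif_prob R (A j).
Proof.
elim/big_rec2: _ => [|j p B _ IH]; first by rewrite /unif_prob cards0 mul0r.
by apply: le_trans (unif_probU _ _ _) _; rewrite lerD2l.
Qed.

Lemma unif_probC (R : realType) (T : finType) (A : {set T}) :
  (0 < #|T|)%N -> unif_prob R A = 1 - unif_prob R (~: A).
Proof.
move=> T0; have TN0 : #|T|%:R != 0 :> R by rewrite pnatr_eq0 -lt0n.
by apply/esym/eqP; rewrite subr_eq /unif_prob -mulrDl -natrD cardsC mulfV.
Qed.

Lemma cycles_upto_mono (n m1 m2 : nat) (s : 'S_n) :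
  (m1 <= m2)%N -> (cycles_upto m1 s <= cycles_upto m2 s)%N.
Proof.
move=> m12; apply/subset_leq_card/subsetP => c; rewrite !inE => /andP[-> cm].
exact: leq_trans cm m12.
Qed.

(** Compare with the telescoping series of 1/(j-1) - 1/j = 1/(j(j-1)). *)
Lemma sum_inv_sqr_le (R : realType) (J N : nat) : (1 < J)%N ->
  \sum_(J <= j < N) (j%:R ^+ 2)^-1 <= (J%:R - 1)^-1 :> R.
Proof.
move=> J1; have J1R : 1 < J%:R :> R by rewrite ltr1n.
have [NJ|JN] := leqP N J; first by rewrite big_geq // invr_ge0 subr_ge0 ltW.
pose f j : R := - (j%:R - 1)^-1.
apply: (@le_trans _ _ (\sum_(J <= j < N) (f j.+1 - f j))).
  rewrite big_nat_cond [leRHS]big_nat_cond; apply: ler_sum => j.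
  rewrite andbT => /andP[Jj _].
  have j1 : 1 < j%:R :> R by rewrite ltr1n (leq_trans J1).
  rewrite /f -natr1 addrK; move: (j%:R) j1 => x x1.
  have -> : - x^-1 - - (x - 1)^-1 = (x * (x - 1))^-1.
    by field; apply/andP; split; lra.
  by rewrite lef_pV2 ?posrE ?exprn_gt0 ?mulr_gt0 //; nra.
rewrite telescope_sumr ?(ltnW JN) // /f opprK -[leRHS]add0r lerD2r oppr_le0.
by rewrite invr_ge0 subr_ge0 ler1n (leq_trans _ JN).
Qed.

Definition milestone (R : realType) (j : nat) : nat := Num.truncn (expR j%:R : R).

Lemma milestone_gt0 (R : realType) (j : nat) : (0 < milestone R j)%N.
Proof.
by rewrite truncn_gt0; apply: le_trans (expR_ge1Dx _); rewrite lerDl.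
Qed.

Lemma ln_milestone_le (R : realType) (j : nat) :
  ln (milestone R j)%:R <= j%:R :> R.
Proof.
rewrite -[leRHS](@expRK R) ler_ln ?posrE ?expR_gt0 ?ltr0n ?milestone_gt0 //.
by rewrite truncn_le expR_ge0.
Qed.

Lemma le_ln_milestone (R : realType) (j : nat) :
  j%:R <= ln (milestone R j).+1%:R :> R.
Proof.
rewrite -[leLHS](@expRK R) ler_ln ?posrE ?expR_gt0 ?ltr0Sn //.
by rewrite ltW // truncnS_gt.
Qed.

Definition too_many (R : realType) (n j : nat) : {set 'S_n} :=
  [set s | j%:R + tilt R j * j%:R <= (cycles_upto (milestone R j.+1) s)%:R].

Definition too_few (R : realType) (n j : nat) : {set 'S_n} :=
  [set s | (cycles_upto (milestone R j) s)%:R <= j%:R + 1 - tilt R j * j%:R].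

(** If neither milestone around [m] is exceptional, then monotonicity of
    [cycles_upto] traps the count at [m]; the allowed deviation at [ln m] is at
    least the one at [j], since x ln x increases. *)
Lemma cycles_close_between (R : realType) (n m : nat) (s : 'S_n) :
  (0 < m)%N -> let j := Num.truncn (ln (m%:R : R)) in (0 < j)%N ->
  s \notin too_many R n j -> s \notin too_few R n j -> cycles_close R m s.
Proof.
move=> m0 j j0; rewrite !inE -!ltNge => many few.
have mR : 0 < m%:R :> R by rewrite ltr0n.
have L0 : 0 <= ln m%:R :> R by rewrite ln_ge0 // ler1n.
have := truncn_itv L0; rewrite -/j -[j.+1%:R]natr1 => /andP[jL Lj].
have tiltE : tilt R j * j%:R <= 2 * Num.sqrt (ln m%:R * ln (ln m%:R)).
  have x0 : 0 < j%:R :> R by rewrite ltr0n.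
  have y0 : 0 <= ln j%:R :> R by rewrite ln_ge0 // ler1n.
  rewrite /tilt -mulrA ler_pM2l // -{3}[j%:R](@ger0_norm R) // -sqrtr_sqr.
  rewrite -sqrtrM ?divr_ge0 // expr2 mulrA divfK ?lt0r_neq0 // mulrC.
  rewrite ler_wsqrtr // ler_pM //.
  by rewrite ler_ln ?posrE // (lt_le_trans x0).
have lo : (milestone R j <= m)%N.
  rewrite -(@natrK R m) le_truncn //.
  by rewrite -[leRHS](@lnK R) ?posrE // ler_expR.
have hi : (m <= milestone R j.+1)%N.
  rewrite truncn_ge_nat ?expR_ge0 //.
  by rewrite -[leLHS](@lnK R) ?posrE // ler_expR -natr1 ltW.
have := cycles_upto_mono s lo; have := cycles_upto_mono s hi.
rewrite -2!(ler_nat R) /cycles_close ltr_norml => Chi Clo.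
by apply/andP; split; lra.
Qed.

Lemma invr_le_powRN3 (R : realType) (x : R) :
  1 <= x -> x^-1 <= x `^ (- (1 / 3)).
Proof.
move=> x1; have x0 : 0 <= x by lra.
by rewrite -powR_inv1 // ler_powR //; lra.
Qed.

Theorem theorem1p11 (R : realType) :
  exists K : R, 0 < K /\
    forall (n : nat) (xi : R), (0 < n)%N -> 2 <= xi -> xi <= n%:R ->
      1 - K * (ln xi) `^ (- (1 / 3)) <=
      unif_prob R [set s : 'S_n |
        [forall m : 'I_n.+1, (xi <= m%:R) ==> cycles_close R m s]].
Proof.
exists (4001 + 8 * expR 43); split; first by have := expR_gt0 (43 : R); lra.
move=> n xi n0 xi2 _.
have L0 : 0 < ln xi by apply: ln_gt0; lra.
have e0 := expR_gt0 (43 : R); set K := 4001 + _.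
have p0 : 0 <= ln xi `^ (- (1 / 3)) := powR_ge0 _ _.
(* Below the threshold needed for the tails the claimed lower bound is
   nonpositive, since (ln xi)^(-1/3) is at least 1/4001. *)
have [Lxi|Lxi] := lerP (ln xi) 4001.
  apply: (@le_trans _ _ 0); last by rewrite /unif_prob divr_ge0.
  rewrite subr_le0.
  have [L1|L1] := lerP (ln xi) 1.
    have : ln xi `^ 0 <= ln xi `^ (- (1 / 3)) by apply: ger_powR; lra.
    by rewrite powRr0 /K; nra.
  apply: (@le_trans _ _ (4001 * (ln xi)^-1)).
    by rewrite ler_pdivlMr // mul1r.
  apply: ler_pM; rewrite ?invr_ge0 ?ler0n ?(ltW L0) ?invr_le_powRN3 ?(ltW L1) //.
  by rewrite /K lerDl mulr_ge0 // ltW.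
set good := [set s | _].
pose J := Num.truncn (ln xi); pose N := Num.truncn (ln (n%:R : R)).
have /andP[JL LJ] := truncn_itv (ltW L0); rewrite -/J -[J.+1%:R]natr1 in JL LJ.
have J4 : (4000 <= J)%N by rewrite -(ler_nat R); lra.
have L1 : 1 <= ln xi by lra.
have J2 : 0 < J%:R - 1 :> R /\ ln xi <= 2 * (J%:R - 1) by split; lra.
clear Lxi JL LJ.
have xi0 : 0 < xi by lra.
have bad :
    ~: good \subset \bigcup_(J <= j < N.+1) (too_many R n j :|: too_few R n j).
  apply/subsetP=> s; rewrite !inE => /forallPn[m].
  rewrite negb_imply => /andP[xim mbad].
  have m0 : (0 < m)%N by rewrite -(ltr_nat R) (lt_le_trans xi0).
  pose j := Num.truncn (ln (m%:R : R)).
  have Jj : (J <= j)%N by rewrite le_truncn // ler_ln ?posrE ?ltr0n.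
  have jN : (j < N.+1)%N.
    by rewrite ltnS le_truncn // ler_ln ?posrE ?ltr0n // ler_nat -ltnS.
  rewrite (bigD1_seq j) ?mem_index_iota ?iota_uniq ?Jj //=.
  rewrite in_setU; apply/orP; left; apply: contraR mbad.
  rewrite in_setU negb_or => /andP[many few].
  apply: cycles_close_between many few => //.
  by rewrite (leq_trans _ Jj) // (leq_trans _ J4).
rewrite unif_probC ?card_Sn ?fact_gt0 // lerD2l lerN2.
apply: (le_trans (unif_prob_le R bad)).
apply: (le_trans (unif_prob_bigcup _ _ _ _)).
apply: (@le_trans _ _ (\sum_(J <= j < N.+1) 4 * expR 43 * (j%:R ^+ 2)^-1)).
  rewrite big_nat_cond [leRHS]big_nat_cond; apply: ler_sum => j.
  rewrite andbT => /andP[Jj jN]; have j4 := leq_trans J4 Jj.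
  apply: (le_trans (unif_probU _ _ _)).
  have jn : (milestone R j <= n)%N.
    rewrite -(@natrK R n) le_truncn //.
    rewrite -[leRHS](@lnK R) ?posrE ?ltr0n // ler_expR.
    apply: (@le_trans _ _ N%:R); first by rewrite ler_nat -ltnS.
    by rewrite truncn_le ln_ge0 // ler1n.
  have mj := ln_milestone_le R j.+1; rewrite -[j.+1%:R in leRHS]natr1 in mj.
  have -> : 4 * expR 43 * (j%:R ^+ 2)^-1
      = 2 * expR 43 / j%:R ^+ 2 + 2 * expR 43 / j%:R ^+ 2 :> R by ring.
  apply: lerD; first exact: upper_tail (milestone_gt0 R j.+1) mj.
  exact: lower_tail (le_ln_milestone R j).
rewrite -mulr_sumr.
have J1 : (1 < J)%N by rewrite (leq_trans _ J4).
apply: (@le_trans _ _ (4 * expR 43 * (2 * (ln xi)^-1))).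
  rewrite ler_pM2l ?mulr_gt0 //; apply: (le_trans (sum_inv_sqr_le _ _ J1)).
  by case: J2 => J0 LJ; rewrite ler_pdivlMr // mulrC ler_pdivrMr.
rewrite mulrA; apply: ler_pM; rewrite ?mulr_ge0 ?invr_ge0 ?(ltW L0) ?(ltW e0) //.
  rewrite /K (_ : 4 * expR 43 * 2 = 8 * expR 43 :> R); last by ring.
  by rewrite lerDr ler0n.
exact: invr_le_powRN3.
Qed.
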